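(* Let $n\ge 2$ and let $f:I\to\mathbb{R}^n$ be an $(n-1)$-regular parametrized curve with speed $\nu=\|f'\|$ and Frenet apparatus $\{\kappa_1,\dots,\kappa_{n-1},V_1,\dots,V_n\}$. For $X\in\mathbb{R}^n$ and fixed $t\in I$, let $[X]_j$ denote the $j$-th coordinate of $X$ in the Frenet frame, i.e. $X=[X]_1V_1(t)+\cdots+[X]_nV_n(t)$. Then, at every $t\in I$: (i) $[f']_1=\nu$ and $[f^{(m)}]_m=\kappa_1\kappa_2\cdots\kappa_{m-1}\,\nu^m$ for $2\le m\le n$; (ii) $f'=\nu V_1$ and, for $2\le m\le n$, $$f'\wedge f''\wedge\cdots\wedge f^{(m)}=\nu^{\frac{m(m+1)}{2}}\,\kappa_1^{m-1}\kappa_2^{m-2}\cdots\kappa_{m-1}\;V_1\wedge V_2\wedge\cdots\wedge V_m .$$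
   Context: Curves are smooth maps defined on an interval $I$. A curve $f$ is $k$-regular if $f'(t),\dots,f^{(k)}(t)$ are linearly independent for all $t\in I$. For an $(n-1)$-regular curve $f:I\to\mathbb{R}^n$, the Frenet apparatus $\{\kappa_1,\dots,\kappa_{n-1},V_1,\dots,V_n\}$ consists of a positively oriented orthonormal frame field $V_1,\dots,V_n$ along $f$ (the Frenet frame) and real functions $\kappa_1,\dots,\kappa_{n-1}$ on $I$ (the curvatures), with $\kappa_j>0$ for $j<n-1$, such that $V_1=f'/\nu$, $\mathrm{span}\{f',\dots,f^{(j)}\}=\mathrm{span}\{V_1,\dots,V_j\}$ for $1\le j\le n-1$, and the Frenet equations hold: $V_1'=\kappa_1\nu V_2$, $V_j'=-\kappa_{j-1}\nu V_{j-1}+\kappa_j\nu V_{j+1}$ for $2\le j\le n-1$, $V_n'=-\kappa_{n-1}\nu V_{n-1}$. *)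

(* Defs.v *)
From HB Require Import structures.
From mathcomp Require Import all_boot all_order all_algebra.
From mathcomp Require Import all_classical all_reals all_analysis.
From mathcomp Require Import ring.

Set Implicit Arguments.
Unset Strict Implicit.
Unset Printing Implicit Defensive.

Import Order.TTheory GRing.Theory Num.Theory.
Import numFieldNormedType.Exports.

Local Open Scope ring_scope.

Section Curves.
Local Open Scope classical_set_scope.
Context {R : realType} {n : nat}.
Implicit Types (I : set R) (f : R -> 'rV[R]_n) (t : R).

(* An interval may be open, closed, half-open or unbounded, but is not reduced
   to a point. *)
Definition nondegenerate_interval I : Prop :=
  is_interval I /\ exists a b : R, [/\ I a, I b & a < b].

(* A curve on I is a total function of which only the values on I matter.
   Difference quotients are taken along points of I only: at an interior point
   this is the usual derivative, at an end point of I the one-sided one. *)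
Definition has_deriv_on I f t (l : 'rV[R]_n) : Prop :=
  (s - t)^-1 *: (f s - f t) @[s --> within I t^'] --> l.

Definition deriv_on I f t : 'rV[R]_n :=
  lim ((s - t)^-1 *: (f s - f t) @[s --> within I t^']).

Definition derivn_on I (k : nat) f : R -> 'rV[R]_n := iter k (deriv_on I) f.

Definition smooth_on I f : Prop :=
  forall k t, I t ->
    has_deriv_on I (derivn_on I k f) t (derivn_on I k.+1 f t).

Definition regular_on I (k : nat) f : Prop :=
  forall t, I t -> free [seq derivn_on I j f t | j <- iota 1 k].

(* The norm of the library on row vectors is the sup norm, hence enorm. *)
Definition dotv (u v : 'rV[R]_n) : R := \sum_(i < n) u 0 i * v 0 i.

Definition enorm (u : 'rV[R]_n) : R := Num.sqrt (dotv u u).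

Definition speed_on I f t : R := enorm (deriv_on I f t).

(* The vectors of the frame and the curvatures are numbered from 1; the values
   of V and kappa at other indices play no role. *)
Definition frame (V : nat -> R -> 'rV[R]_n) t : n.-tuple 'rV[R]_n :=
  [tuple V i.+1 t | i < n].

Record frenet_apparatus I f
    (kappa : nat -> R -> R) (V : nat -> R -> 'rV[R]_n) : Prop := {
  frenet_orthonormal : forall t, I t -> forall i j,
    (1 <= i <= n)%N -> (1 <= j <= n)%N -> dotv (V i t) (V j t) = (i == j)%:R;
  frenet_oriented : forall t, I t -> 0 < \det (\matrix_(i < n) V i.+1 t);
  frenet_curvature_gt0 : forall t, I t -> forall j,
    (1 <= j < n.-1)%N -> 0 < kappa j t;
  frenet_tangent : forall t, I t ->
    V 1%N t = (speed_on I f t)^-1 *: deriv_on I f t;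
  frenet_span : forall t, I t -> forall j, (1 <= j <= n.-1)%N ->
    <<[seq derivn_on I k f t | k <- iota 1 j]>>%VS =
    <<[seq V k t | k <- iota 1 j]>>%VS;
  frenet_first : forall t, I t ->
    has_deriv_on I (V 1%N) t ((kappa 1%N t * speed_on I f t) *: V 2%N t);
  frenet_mid : forall t, I t -> forall j, (2 <= j <= n.-1)%N ->
    has_deriv_on I (V j) t
      (- (kappa j.-1 t * speed_on I f t) *: V j.-1 t
       + (kappa j t * speed_on I f t) *: V j.+1 t);
  frenet_last : forall t, I t ->
    has_deriv_on I (V n) t
      (- (kappa n.-1 t * speed_on I f t) *: V n.-1 t) }.

End Curves.

(* The exterior algebra of R^n, on the basis e_A = e_i1 /\ ... /\ e_ip indexed
   by the subsets A = {i1 < ... < ip} of 'I_n. For disjoint A and B one has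
   e_A /\ e_B = (-1)^(ext_inv A B) e_(A :|: B), where ext_inv A B counts the
   inversions of the concatenation of A and B, and e_A /\ e_B = 0 when A and B
   meet. *)
Section ExteriorAlgebra.
Local Open Scope set_scope.
Context {R : comNzRingType} {n : nat}.
Local Notation exterior := {ffun {set 'I_n} -> R^o}.

Definition ext_inv (A B : {set 'I_n}) : nat :=
  (\sum_(i in A) \sum_(j in B) (j < i))%N.

Definition ext_mul (u v : exterior) : exterior :=
  [ffun C : {set 'I_n} =>
    \sum_(A : {set 'I_n} | A \subset C)
      (-1) ^+ ext_inv A (C :\: A) * (u A * v (C :\: A))].

Definition ext_one : exterior := [ffun C => (C == finset.set0)%:R].

Definition ext_vec (x : 'rV[R]_n) : exterior :=
  [ffun C => \sum_(i < n | C == [set i]%SET) x 0 i].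

Lemma ext_mul1v (u : exterior) : ext_mul ext_one u = u.
Proof.
apply/ffunP => C; rewrite ffunE (bigD1 finset.set0) ?finset.sub0set //=.
rewrite finset.setD0 ffunE eqxx.
rewrite /ext_inv big_set0 mul1r mul1r big1 ?addr0 // => A /andP[_ /negbTE h].
by rewrite ffunE h mul0r mulr0.
Qed.

Lemma ext_mulv1 (u : exterior) : ext_mul u ext_one = u.
Proof.
apply/ffunP => C; rewrite ffunE (bigD1 C) //= finset.setDv ffunE eqxx.
rewrite /ext_inv big1; last by move=> i _; rewrite big_set0.
rewrite mul1r mulr1 big1 ?addr0 // => A /andP[sA nA].
rewrite ffunE (_ : _ == _ = false) ?mulr0 // finset.setD_eq0.
by apply/negP => h; case/negP: nA; rewrite finset.eqEsubset sA.
Qed.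

Lemma ext_invUl (A B C : {set 'I_n}) : [disjoint A & B] ->
  ext_inv (A :|: B) C = (ext_inv A C + ext_inv B C)%N.
Proof.
by move=> d; rewrite /ext_inv -bigU //; apply: eq_bigl => i; rewrite !inE.
Qed.

Lemma ext_invUr (A B C : {set 'I_n}) : [disjoint B & C] ->
  ext_inv A (B :|: C) = (ext_inv A B + ext_inv A C)%N.
Proof.
move=> d; rewrite /ext_inv -big_split; apply: eq_bigr => i _.
by rewrite -bigU //; apply: eq_bigl => j; rewrite !inE.
Qed.

Lemma ext_mulA : associative ext_mul.
Proof.
move=> u v w; apply/ffunP => C; rewrite !ffunE.
transitivity (\sum_(B : {set 'I_n} | B \subset C)
  \sum_(A : {set 'I_n} | (B \subset A) && (A \subset C))
    (-1) ^+ (ext_inv B (C :\: A) + ext_inv (A :\: B) (C :\: A)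
             + ext_inv B (A :\: B))
    * (u B * v (A :\: B) * w (C :\: A)) : R).
  apply: eq_bigr => B sB; rewrite ffunE.
  rewrite mulr_sumr mulr_sumr.
  rewrite (reindex_onto (fun A => A :\: B) (fun D => D :|: B)) /=; last first.
    move=> D /fintype.subsetP sD; apply/setP => x; rewrite !inE.
    case xB: (x \in B) => //=; last by rewrite orbF.
    by apply/esym/negP => /sD; rewrite inE xB.
  apply: eq_big => [A|A].
    apply/andP/andP => [[/fintype.subsetP h1 /eqP <-]|[h1 h2]]; split.
    - by rewrite finset.subsetUr.
    - rewrite finset.subUset sB andbT.
      by apply/fintype.subsetP => x /h1; rewrite inE => /andP[].
    - by apply: finset.setSD.
    - apply/eqP/setP => x; rewrite !inE.
      case xB: (x \in B) => //=; last by rewrite orbF.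
      by rewrite (fintype.subsetP h1).
  move=> /andP[/fintype.subsetP h1 /eqP h2].
  have sBA : B \subset A by rewrite -h2 finset.subsetUr.
  have e : (C :\: B) :\: (A :\: B) = C :\: A.
    apply/setP => x; rewrite !inE.
    by case xB: (x \in B) => //=; rewrite (fintype.subsetP sBA).
  have e2 : C :\: B = (A :\: B) :|: (C :\: A).
    apply/setP => x; rewrite !inE.
    case xB: (x \in B) => /=; first by rewrite (fintype.subsetP sBA).
    case xA: (x \in A) => //=; have := h1 x; rewrite !inE xA xB /=; exact.
  rewrite e [in ext_inv B (C :\: B)]e2 ext_invUr; last first.
    rewrite -finset.setI_eq0; apply/eqP/setP => x; rewrite !inE.
    by case: (x \in A); rewrite ?andbF.
  by rewrite !exprD -!mulrA; ring.
rewrite (exchange_big_dep (fun A : {set 'I_n} => A \subset C)) /=; last first.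
  by move=> i j _ /andP[].
apply: eq_bigr => A sA; rewrite ffunE mulr_suml mulr_sumr.
apply: eq_big => [B|B /andP[_ /andP[sB _]]].
  by rewrite sA andbT andb_idl // => h; exact: (fintype.subset_trans h).
rewrite -[in ext_inv A](finset.setUidPr sB).
have -> : B :|: A = B :|: (A :\: B).
  by apply/setP => x; rewrite !inE; case: (x \in B).
rewrite ext_invUl; last first.
  rewrite -finset.setI_eq0; apply/eqP/setP => x; rewrite !inE.
  by case: (x \in B).
by rewrite exprD -!mulrA.
Qed.

HB.instance Definition _ :=
  Monoid.isLaw.Build exterior ext_one ext_mul ext_mulA ext_mul1v ext_mulv1.

End ExteriorAlgebra.

(* Main.v *)
Require Import Defs.
From mathcomp Require Import all_boot all_order all_algebra.
From mathcomp Require Import all_classical all_reals all_analysis.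
From mathcomp Require Import zify ring.

(** Write nu for the speed, c m j for the scalar product of the m-th derivative
    of f with V j, and note that, the frame being orthonormal, c m j is the
    j-th Frenet coordinate of that derivative ([coord_orthonormal]).

    By the condition on spans, c m j vanishes on all of I when m < n and m < j
    ([derivn_on_orthogonal]). Differentiating the identity c m (m+1) = 0 along
    the curve gives c (m+1) (m+1) = - f^(m) . V_(m+1)'. In the Frenet equation
    for V_(m+1)' only the term - kappa_m nu V_m contributes, because f^(m) is
    orthogonal to V_(m+2); so c (m+1) (m+1) = kappa_m nu c m m
    ([dotv_derivnS]). Starting from f' = nu V_1, this recursion gives (i)
    ([dotv_derivn_diag]).

    For (ii), the derivatives are obtained from the frame by a triangular
    matrix with diagonal entries c k k ([derivn_on_triangular]). In a wedge
    product the off-diagonal terms repeat a vector that is already present and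
    disappear, so that the wedge product of the derivatives is that of the
    frame times the product of the diagonal entries ([ext_prod_triangular]);
    collecting powers gives the stated factor ([prod_triangular_powers]). *)

Set Implicit Arguments.
Unset Strict Implicit.
Unset Printing Implicit Defensive.

Import Order.TTheory GRing.Theory Num.Theory.
Import numFieldNormedType.Exports.

Local Open Scope classical_set_scope.
Local Open Scope ring_scope.

(** * Wedge products of vectors *)

Section ExteriorProduct.
Context {R : comNzRingType} {n : nat}.
Implicit Types (u v w : {ffun {set 'I_n} -> R^o}) (x y : 'rV[R]_n).

Lemma ext_mulDr u v w : ext_mul u (v + w) = ext_mul u v + ext_mul u w.
Proof.
apply/ffunP => C; rewrite !ffunE -big_split; apply: eq_bigr => A _ /=.
by rewrite !ffunE -mulrDr -mulrDr.
Qed.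

Lemma ext_mulZr (a : R) u v : ext_mul u (a *: v) = a *: ext_mul u v.
Proof.
apply/ffunP => C; rewrite !ffunE scaler_sumr; apply: eq_bigr => A _ /=.
by rewrite !ffunE /GRing.scale /=; ring.
Qed.

Lemma ext_mulZl (a : R) u v : ext_mul (a *: u) v = a *: ext_mul u v.
Proof.
apply/ffunP => C; rewrite !ffunE scaler_sumr; apply: eq_bigr => A _ /=.
by rewrite !ffunE /GRing.scale /=; ring.
Qed.

Lemma ext_mul0r u : ext_mul u 0 = 0.
Proof.
rewrite -[X in ext_mul u X](scale0r (0 : {ffun {set 'I_n} -> R^o})).
by rewrite ext_mulZr scale0r.
Qed.

Lemma ext_mul_sumr (J : Type) (r : seq J) (P : pred J) u
    (F : J -> {ffun {set 'I_n} -> R^o}) :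
  ext_mul u (\sum_(j <- r | P j) F j) = \sum_(j <- r | P j) ext_mul u (F j).
Proof.
apply: (big_morph (ext_mul u)); [exact: ext_mulDr | exact: ext_mul0r].
Qed.

Lemma ext_vecD x y : ext_vec (x + y) = ext_vec x + ext_vec y.
Proof.
apply/ffunP => C; rewrite !ffunE -big_split; apply: eq_bigr => i _ /=.
by rewrite mxE.
Qed.

Lemma ext_vecZ (a : R) x : ext_vec (a *: x) = a *: ext_vec x.
Proof.
apply/ffunP => C; rewrite !ffunE scaler_sumr; apply: eq_bigr => i _ /=.
by rewrite mxE.
Qed.

Lemma ext_vec0 : ext_vec (0 : 'rV[R]_n) = 0.
Proof.
by rewrite -[X in ext_vec X](scale0r (0 : 'rV[R]_n)) ext_vecZ scale0r.
Qed.

Lemma ext_vec_sum (J : Type) (r : seq J) (P : pred J) (F : J -> 'rV[R]_n) :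
  ext_vec (\sum_(j <- r | P j) F j) = \sum_(j <- r | P j) ext_vec (F j).
Proof. apply: (big_morph ext_vec); [exact: ext_vecD | exact: ext_vec0]. Qed.

Lemma ext_vec_neq0 x (C : {set 'I_n}) :
  ext_vec x C != 0 -> exists i, C = [set i]%SET.
Proof.
rewrite ffunE; case: (pickP (fun i => C == [set i]%SET)) => [i /eqP -> _|h].
  by exists i.
by rewrite big_pred0 ?eqxx.
Qed.

(** Exchanging A with its complement in C matches the terms of the two sums;
    a nonzero term has A = {i} and C minus A = {j} with i != j, and exactly one
    of the sequences (i, j) and (j, i) has an inversion, whence opposite
    signs. *)
Lemma ext_vec_anticomm x y :
  ext_mul (ext_vec x) (ext_vec y) = - ext_mul (ext_vec y) (ext_vec x).
Proof.
apply/ffunP => C; rewrite !ffunE -sumrN.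
rewrite (reindex_onto (fun A => C :\: A)%SET (fun A => C :\: A)%SET) /=;
  last first.
  by move=> A /finset.setIidPr; rewrite finset.setDDr finset.setDv finset.set0U.
apply: eq_big => [A|A /andP[_ /eqP ->]].
  rewrite finset.subsetDl finset.setDDr finset.setDv finset.set0U /=.
  by apply/eqP/idP => /finset.setIidPr.
have [->|/ext_vec_neq0[i Ei]] := eqVneq (ext_vec y A) 0.
  by rewrite mul0r !mulr0 oppr0.
have [->|/ext_vec_neq0[j Ej]] := eqVneq (ext_vec x (C :\: A)%SET) 0.
  by rewrite mul0r !mulr0 oppr0.
have ij : i != j.
  have : j \in (C :\: A)%SET by rewrite Ej finset.in_set1.
  by rewrite Ei !inE eq_sym => /andP[].
have -> : (-1) ^+ ext_inv (C :\: A)%SET A =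
    - (-1) ^+ ext_inv A (C :\: A)%SET :> R.
  rewrite Ej Ei /ext_inv !big_set1; move: ij; rewrite -val_eqE /=.
  by case: ltngtP => //= _ _; rewrite !(expr0, expr1) ?opprK.
by ring.
Qed.

End ExteriorProduct.

Section ExteriorPower.
Context {R : numDomainType} {n : nat}.
Implicit Types (x : 'rV[R]_n).

(** Anticommutativity only gives 2 (x /\ x) = 0: this is where characteristic
    0 is used. *)
Lemma ext_vec_sqr0 x : ext_mul (ext_vec x) (ext_vec x) = 0.
Proof.
have /ffunP h := ext_vec_anticomm x x.
apply/ffunP => C; have := h C; rewrite [in RHS]ffunE => e.
have : ext_mul (ext_vec x) (ext_vec x) C *+ 2 = 0 by rewrite mulr2n {1}e addNr.
by move/eqP; rewrite mulrn_eq0 /= => /eqP ->; rewrite ffunE.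
Qed.

(** The last factor is moved to the left by anticommutativity until it meets
    its copy. *)
Lemma ext_prod_absorb (v : nat -> 'rV[R]_n) m j : (1 <= j <= m)%N ->
  ext_mul (\big[ext_mul/ext_one]_(1 <= k < m.+1) ext_vec (v k))
    (ext_vec (v j)) = 0.
Proof.
elim: m => [|m IH] hj; first by lia.
rewrite big_nat_recr //= -ext_mulA.
have [->|jm] := eqVneq j m.+1; first by rewrite ext_vec_sqr0 ext_mul0r.
rewrite ext_vec_anticomm -scaleN1r ext_mulZr ext_mulA IH; last by lia.
by rewrite -ext_mulZr -[X in ext_mul X _](scale0r 0) ext_mulZl scale0r.
Qed.

(** The wedge version of the fact that a triangular determinant is the product
    of its diagonal entries. *)
Lemma ext_prod_triangular (v w : nat -> 'rV[R]_n) (a : nat -> R)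
    (c : nat -> nat -> R) m :
  (forall k, (1 <= k <= m)%N ->
     w k = a k *: v k + \sum_(1 <= j < k) c k j *: v j) ->
  \big[ext_mul/ext_one]_(1 <= k < m.+1) ext_vec (w k) =
  (\prod_(1 <= k < m.+1) a k) *:
    \big[ext_mul/ext_one]_(1 <= k < m.+1) ext_vec (v k).
Proof.
elim: m => [|m IH] h; first by rewrite !big_geq // scale1r.
rewrite (big_nat_recr m.+1) //= IH; last by move=> k hk; apply: h; lia.
rewrite h; last by lia.
rewrite (big_nat_recr m.+1 1 (fun k => a k)) // (big_nat_recr m.+1) //=.
rewrite ext_vecD ext_mulDr ext_vec_sum ext_mul_sumr.
rewrite [X in _ + X]big_nat [X in _ + X]big1 ?addr0.
  by rewrite ext_vecZ ext_mulZr ext_mulZl scalerA mulrC.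
move=> j hj; rewrite ext_vecZ ext_mulZr ext_mulZl.
by rewrite ext_prod_absorb ?scaler0 //; lia.
Qed.

End ExteriorPower.

(** * The Euclidean scalar product and orthonormal frames *)

Section DotProduct.
Context {R : realType} {n : nat}.
Implicit Types (x y z : 'rV[R]_n).

Lemma dotvC x y : dotv x y = dotv y x.
Proof. by apply: eq_bigr => i _; rewrite mulrC. Qed.

Lemma dotvDl x y z : dotv (x + y) z = dotv x z + dotv y z.
Proof. by rewrite -big_split; apply: eq_bigr => i _; rewrite mxE mulrDl. Qed.

Lemma dotvZl a x y : dotv (a *: x) y = a * dotv x y.
Proof. by rewrite mulr_sumr; apply: eq_bigr => i _; rewrite mxE mulrA. Qed.

Lemma dotvDr x y z : dotv z (x + y) = dotv z x + dotv z y.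
Proof. by rewrite !(dotvC z) dotvDl. Qed.

Lemma dotvZr a x y : dotv x (a *: y) = a * dotv x y.
Proof. by rewrite !(dotvC x) dotvZl. Qed.

Lemma dotvBl x y z : dotv (x - y) z = dotv x z - dotv y z.
Proof. by rewrite -scaleN1r dotvDl dotvZl mulN1r. Qed.

Lemma dotvBr x y z : dotv z (x - y) = dotv z x - dotv z y.
Proof. by rewrite !(dotvC z) dotvBl. Qed.

Lemma dotv0l x : dotv 0 x = 0.
Proof. by rewrite -(scale0r 0) dotvZl mul0r. Qed.

Lemma dotv_suml (J : Type) (r : seq J) (P : pred J) (F : J -> 'rV[R]_n) y :
  dotv (\sum_(j <- r | P j) F j) y = \sum_(j <- r | P j) dotv (F j) y.
Proof.
by apply: (big_morph (dotv^~ y)) => [u v|]; [exact: dotvDl | exact: dotv0l].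
Qed.

Lemma dotvv_eq0 x : (dotv x x == 0) = (x == 0).
Proof.
apply/eqP/eqP => [|->]; last by rewrite dotv0l.
move/eqP; rewrite psumr_eq0 => [/allP h|i _]; last by rewrite -expr2 sqr_ge0.
apply/rowP => i; rewrite mxE; apply/eqP.
by have := h i (mem_index_enum _); rewrite /= mulf_eq0 orbb.
Qed.

Lemma dotv_span0 (s : seq 'rV[R]_n) x y :
  (forall z, z \in s -> dotv z y = 0) -> x \in << s >>%VS -> dotv x y = 0.
Proof.
move=> h xs; rewrite (coord_span (X := in_tuple s) xs) dotv_suml big1 // => i _.
by rewrite dotvZl h ?mulr0 // mem_nth.
Qed.

Section Orthonormal.
Variable X : n.-tuple 'rV[R]_n.
Hypothesis orthoX : forall i j : 'I_n, dotv X`_i X`_j = (i == j)%:R.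

Lemma dotv_sum_orthonormal (k : 'I_n -> R) (j : 'I_n) :
  dotv (\sum_i k i *: X`_i) X`_j = k j.
Proof.
rewrite dotv_suml (bigD1 j) //= dotvZl orthoX eqxx mulr1 big1 ?addr0 // => i ij.
by rewrite dotvZl orthoX (negbTE ij) mulr0.
Qed.

Lemma orthonormal_expansion x : x = \sum_(i < n) dotv x X`_i *: X`_i.
Proof.
have Xfree : free X.
  by apply/freeP => k k0 i; rewrite -(dotv_sum_orthonormal k) k0 dotv0l.
have Xbasis : basis_of fullv X.
  by rewrite basisEfree Xfree subvf dimvf /dim /= mul1n size_tuple leqnn.
have xX : x \in <<X>>%VS by rewrite (span_basis Xbasis) memvf.
rewrite {1}(coord_span xX); apply: eq_bigr => i _; congr (_ *: _).
by rewrite [in RHS](coord_span xX) dotv_sum_orthonormal.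
Qed.

Lemma coord_orthonormal (i : 'I_n) x : coord X i x = dotv x X`_i.
Proof.
rewrite {1}(orthonormal_expansion x) coord_sum_free //.
by apply/freeP => k k0 j; rewrite -(dotv_sum_orthonormal k) k0 dotv0l.
Qed.

End Orthonormal.
End DotProduct.

(** * Derivatives along an interval *)

Section Differentiation.
Context {R : realType} {n : nat}.
Variable (I : set R).
Implicit Types (u v : R -> 'rV[R]_n) (t : R).

Lemma dotv_cvg (T : Type) (F : set_system T) (FF : Filter F)
    (u v : T -> 'rV[R]_n) (a b : 'rV[R]_n) :
  u x @[x --> F] --> a -> v x @[x --> F] --> b ->
  dotv (u x) (v x) @[x --> F] --> dotv a b.
Proof.
move=> ua vb; apply: cvg_big => [|i _]; first exact: add_continuous.
apply: cvgM.
  exact: (cvg_comp _ _ ua (@coord_continuous _ _ _ 0 i a)).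
exact: (cvg_comp _ _ vb (@coord_continuous _ _ _ 0 i b)).
Qed.

(** Limits of difference quotients taken along I are unique because every point
    of a nondegenerate interval, end points included, is a limit of other
    points of it. *)
Lemma within_interval_dnbhs_proper t : nondegenerate_interval I -> I t ->
  ProperFilter (within I t^').
Proof.
move=> [Iitv [a [b [Ia Ib ab]]]] It; apply: Build_ProperFilter.
rewrite /within /= => /nbhs_ballP [e /= e0 he].
(* In both cases the witness s lies between t and whichever of b and a differs
   from t, hence in I, and at distance at most e / 2 from t. *)
have [tb|bt] := ltP t b.
- pose s := t + Num.min (e / 2) (b - t).
  have m0 : 0 < Num.min (e / 2) (b - t) by rewrite lt_min divr_gt0 // subr_gt0.
  apply: (he s); rewrite /ball /= ?/s.
  + rewrite opprD addNKr normrN gtr0_norm // gt_min.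
    by rewrite ltr_pdivrMr // ltr_pMr // ltr1n.
  + by rewrite gt_eqF // ltrDl.
  + apply: (Iitv t b) => //; rewrite lerDl (ltW m0) /=.
    by rewrite -lerBrDl ge_min lexx orbT.
have ta : a < t by apply: lt_le_trans bt.
pose s := t - Num.min (e / 2) (t - a).
have m0 : 0 < Num.min (e / 2) (t - a) by rewrite lt_min divr_gt0 // subr_gt0.
apply: (he s); rewrite /ball /= ?/s.
- rewrite opprD opprK addNKr gtr0_norm // gt_min.
  by rewrite ltr_pdivrMr // ltr_pMr // ltr1n.
- by rewrite lt_eqF // gtrBl.
- apply: (Iitv a t) => //; rewrite gerBl (ltW m0) andbT.
  by rewrite lerBrDl -lerBrDr ge_min lexx orbT.
Qed.

(** u s - u t is the product of s - t, which tends to 0, with the convergent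
    difference quotient. *)
Lemma has_deriv_on_cvg u t l : has_deriv_on I u t l ->
  u s @[s --> within I t^'] --> u t.
Proof.
move=> du.
have dt : (s - t : R) @[s --> within I t^'] --> (0 : R).
  rewrite -(subrr t); apply: cvg_within_filter.
  by apply: cvg_within_filter; apply: cvgB; [exact: cvg_id | exact: cvg_cst].
have : (s - t) *: ((s - t)^-1 *: (u s - u t)) + u t @[s --> within I t^']
    --> 0 *: l + u t.
  by apply: cvgD; [exact: cvgZ | exact: cvg_cst].
rewrite scale0r add0r; apply: cvg_trans; apply: near_eq_cvg.
rewrite near_withinE; near=> s => _.
rewrite /= scalerA divff ?scale1r ?subrK // subr_eq0.
by near: s; exact: nbhs_dnbhs_neq.
Unshelve. all: by end_near. Qed.

(** The Leibniz rule, in the only case needed: when the scalar product is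
    constantly zero on I, so is its derivative. *)
Lemma dotv_deriv_eq0 u v t (u' v' : 'rV[R]_n) :
  nondegenerate_interval I -> I t ->
  has_deriv_on I u t u' -> has_deriv_on I v t v' ->
  (forall s, I s -> dotv (u s) (v s) = 0) ->
  dotv u' (v t) + dotv (u t) v' = 0.
Proof.
move=> hI It du dv uv0.
have PF := within_interval_dnbhs_proper hI It.
have Leibniz : dotv ((s - t)^-1 *: (u s - u t)) (v s)
    + dotv (u t) ((s - t)^-1 *: (v s - v t)) @[s --> within I t^']
    --> dotv u' (v t) + dotv (u t) v'.
  apply: cvgD; first by apply: dotv_cvg => //; exact: has_deriv_on_cvg dv.
  by apply: dotv_cvg => //; exact: cvg_cst.
apply: (cvg_unique (@Rhausdorff R) Leibniz).
have : (0 : R) @[s --> within I t^'] --> (0 : R) by exact: cvg_cst.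
apply: cvg_trans; apply: near_eq_cvg.
rewrite near_withinE; near=> s => Is /=.
by rewrite dotvZl dotvZr dotvBl dotvBr !uv0 //; ring.
Unshelve. all: by end_near. Qed.

End Differentiation.

(** * The derivatives of a curve in its Frenet frame *)

Section Frenet.
Context {R : realType} {n : nat}.
Variables (I : set R) (f : R -> 'rV[R]_n).
Variables (kappa : nat -> R -> R) (V : nat -> R -> 'rV[R]_n).
Hypotheses (hn : (2 <= n)%N) (hI : nondegenerate_interval I).
Hypotheses (hf : smooth_on I f) (hreg : regular_on I n.-1 f).
Hypothesis hF : frenet_apparatus I f kappa V.

Lemma speed_neq0 t : I t -> speed_on I f t != 0.
Proof.
move=> It; rewrite /speed_on /enorm sqrtr_eq0 -ltNge lt_neqAle eq_sym dotvv_eq0.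
rewrite sumr_ge0 => [|i _]; last by rewrite -expr2 sqr_ge0.
rewrite andbT; apply: contraL (hreg It).
have -> : n.-1 = n.-2.+1 by lia.
by rewrite /= => /eqP f0; rewrite free_cons /derivn_on /= f0 mem0v.
Qed.

Lemma deriv_on_tangent t : I t -> deriv_on I f t = speed_on I f t *: V 1%N t.
Proof.
move=> It; rewrite (frenet_tangent hF It) scalerA.
by rewrite divff ?scale1r // speed_neq0.
Qed.

Lemma derivn_on_orthogonal t m j : I t -> (1 <= m < n)%N -> (m < j <= n)%N ->
  dotv (derivn_on I m f t) (V j t) = 0.
Proof.
move=> It hm hj.
apply: (@dotv_span0 _ _ [seq V k t | k <- iota 1 m]) => [z|].
  case/mapP => k; rewrite mem_iota => hk ->.
  rewrite (frenet_orthonormal hF It); [|lia|lia].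
  by have -> : (k == j) = false by lia.
rewrite -(frenet_span hF It); last by lia.
by apply/memv_span/mapP; exists m => //; rewrite mem_iota; lia.
Qed.

(** A common form of the two Frenet equations for j < n and j = n: the
    remainder w is a multiple of V (j+1) or zero, and all that matters is that
    the derivatives of order less than j do not see it. *)
Lemma frenet_deriv t j : I t -> (2 <= j <= n)%N ->
  exists2 w : 'rV[R]_n, has_deriv_on I (V j) t
               (- (kappa j.-1 t * speed_on I f t) *: V j.-1 t + w)
    & forall m, (1 <= m < n)%N -> (m < j)%N -> dotv (derivn_on I m f t) w = 0.
Proof.
move=> It hj; have [jn|jn] := eqVneq j n.
  exists 0; last by move=> m _ _; rewrite dotvC dotv0l.
  by rewrite jn addr0; exact: (frenet_last hF It).
exists ((kappa j t * speed_on I f t) *: V j.+1 t).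
  by apply: (frenet_mid hF It); lia.
by move=> m hm mj; rewrite dotvZr derivn_on_orthogonal ?mulr0 //; lia.
Qed.

(** The key recursion, obtained by differentiating f^(m) . V (m+1) = 0 along
    I. *)
Lemma dotv_derivnS t m : I t -> (1 <= m < n)%N ->
  dotv (derivn_on I m.+1 f t) (V m.+1 t) =
  kappa m t * speed_on I f t * dotv (derivn_on I m f t) (V m t).
Proof.
move=> It hm.
have hm1 : (2 <= m.+1 <= n)%N by lia.
have [w dV w0] := frenet_deriv It hm1.
have := dotv_deriv_eq0 hI It (@hf m t It) dV.
rewrite dotvDr dotvZr w0 //= addr0 mulNr => h.
apply/eqP; rewrite -subr_eq0; apply/eqP; apply: h => s Is.
by apply: derivn_on_orthogonal => //; lia.
Qed.

Lemma dotv_derivn_diag t m : I t -> (1 <= m <= n)%N ->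
  dotv (derivn_on I m f t) (V m t) =
  (\prod_(1 <= j < m) kappa j t) * speed_on I f t ^+ m.
Proof.
move=> It; elim: m => // -[_ _|m IH hm].
  rewrite /derivn_on /= deriv_on_tangent // dotvZl.
  rewrite (frenet_orthonormal hF It) ?eqxx; [|lia|lia].
  by rewrite big_geq // mulr1 mul1r.
rewrite dotv_derivnS // IH; last by lia.
by rewrite (big_nat_recr m.+1) //= !exprS; ring.
Qed.

Lemma frame_nth t (i : 'I_n) : (frame V t)`_i = V i.+1 t.
Proof. by rewrite -tnth_nth tnth_mktuple. Qed.

Lemma frame_orthonormal t : I t ->
  forall i j : 'I_n, dotv (frame V t)`_i (frame V t)`_j = (i == j)%:R.
Proof.
move=> It i j; rewrite !frame_nth (frenet_orthonormal hF It) ?ltn_ord //.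
Qed.

Lemma frenet_expansion t x : I t ->
  x = \sum_(1 <= j < n.+1) dotv x (V j t) *: V j t.
Proof.
move=> It; rewrite [LHS](orthonormal_expansion (frame_orthonormal It)).
rewrite big_add1 big_mkord; apply: eq_bigr => i _.
by rewrite !frame_nth.
Qed.

(** For m < n the components along V j with j > m vanish by the span condition;
    for m = n there are none. *)
Lemma derivn_on_triangular t m : I t -> (1 <= m <= n)%N ->
  derivn_on I m f t =
  ((\prod_(1 <= j < m) kappa j t) * speed_on I f t ^+ m) *: V m t
  + \sum_(1 <= j < m) dotv (derivn_on I m f t) (V j t) *: V j t.
Proof.
move=> It hm; set x := derivn_on I m f t.
rewrite [LHS](frenet_expansion x It) (big_cat_nat (n := m.+1)) //=; [|lia].
rewrite [X in _ + X]big_nat [X in _ + X]big1 => [|j hj].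
  rewrite addr0 big_nat_recr /=; last by lia.
  by rewrite addrC dotv_derivn_diag.
by rewrite derivn_on_orthogonal ?scale0r //; lia.
Qed.

End Frenet.

(** The exponents: c occurs 1 + 2 + ... + m times, and k j is a factor of the
    terms i = j + 1, ..., m, of which there are m - j. *)
Lemma prod_triangular_powers {R : comNzRingType} (c : R) (k : nat -> R) m :
  \prod_(1 <= i < m.+1) ((\prod_(1 <= j < i) k j) * c ^+ i) =
  c ^+ (m * m.+1)./2 * \prod_(1 <= j < m) k j ^+ (m - j).
Proof.
elim: m => [|m IH]; first by rewrite !big_geq // mulr1.
rewrite (big_nat_recr m.+1) // IH.
have -> : ((m.+1 * m.+2)./2 = (m * m.+1)./2 + m.+1)%N.
  have -> : (m.+1 * m.+2 = m * m.+1 + m.+1.*2)%N by lia.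
  by rewrite halfD odd_double andbF doubleK.
have -> : \prod_(1 <= j < m.+1) k j ^+ (m.+1 - j) =
    (\prod_(1 <= j < m.+1) k j) * \prod_(1 <= j < m) k j ^+ (m - j).
  have -> : \prod_(1 <= j < m) k j ^+ (m - j) =
      \prod_(1 <= j < m.+1) k j ^+ (m - j).
    case: m {IH} => [|m]; first by rewrite !big_geq.
    by rewrite [in RHS]big_nat_recr //= subnn expr0 mulr1.
  rewrite -big_split /=; apply: eq_big_nat => j hj.
  by rewrite subSn ?exprS //; lia.
rewrite exprD; move: (c ^+ (m * m.+1)./2) (c ^+ m.+1) => a b; rewrite /=; ring.
Qed.

Theorem theorem3p1 (R : realType) (n : nat) (I : set R) (f : R -> 'rV[R]_n)
    (kappa : nat -> R -> R) (V : nat -> R -> 'rV[R]_n)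
    (hn : (2 <= n)%N)
    (hI : nondegenerate_interval I)
    (hf : smooth_on I f)
    (hreg : regular_on I n.-1 f)
    (hF : frenet_apparatus I f kappa V) :
  forall t : R, I t ->
  [/\ (forall i : 'I_n, i.+1 = 1%N ->
         coord (frame V t) i (deriv_on I f t) = speed_on I f t),
      (forall (m : nat) (i : 'I_n), (2 <= m <= n)%N -> i.+1 = m ->
         coord (frame V t) i (derivn_on I m f t) =
         (\prod_(1 <= j < m) kappa j t) * speed_on I f t ^+ m),
      deriv_on I f t = speed_on I f t *: V 1%N t
    & (forall m : nat, (2 <= m <= n)%N ->
         \big[ext_mul/ext_one]_(1 <= k < m.+1) ext_vec (derivn_on I k f t) =
         (speed_on I f t ^+ (m * m.+1)./2
           * \prod_(1 <= j < m) kappa j t ^+ (m - j))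
         *: \big[ext_mul/ext_one]_(1 <= k < m.+1) ext_vec (V k t))].
Proof.
move=> t It.
have coordE (m : nat) (i : 'I_n) : i.+1 = m ->
    coord (frame V t) i (derivn_on I m f t) =
    (\prod_(1 <= j < m) kappa j t) * speed_on I f t ^+ m.
  move=> im; rewrite (coord_orthonormal (frame_orthonormal hF It)) frame_nth im.
  by apply: (dotv_derivn_diag hn hI hf hreg hF It); have := ltn_ord i; lia.
split=> [i i1|m i _ im||m hm].
- by rewrite (coordE 1%N) // big_geq // mul1r.
- exact: coordE.
- exact: deriv_on_tangent hn hreg hF _ It.
rewrite -prod_triangular_powers; apply: ext_prod_triangular => k hk.
by apply: (derivn_on_triangular hn hI hf hreg hF It); lia.
Qed.
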